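(* For every positive integer $n$, the number of facets of $\mathrm{BTP}(n)$ is $\frac{(n-1)(3n-2)}{2}$.
   Context: A TSSCPP boolean triangle of order $n$ is a triangular array $(b_{i,n-j})_{1\le j\le i\le n-1}$ (so $\binom{n}{2}$ entries) with entries in $\{0,1\}$ such that for all $1\le j<i\le n-1$, $$1+\sum_{k=j+1}^{i}b_{k,n-j-1}\ge\sum_{k=j}^{i}b_{k,n-j}.$$ $\mathrm{BTP}(n)$ is the convex hull in $\mathbb{R}^{\binom{n}{2}}$ (coordinates indexed by the positions $(i,n-j)$, $1\le j\le i\le n-1$) of all TSSCPP boolean triangles of order $n$. A facet is a face of dimension one less than the dimension of the polytope. *)

(* Defs.v *)
From HB Require Import structures.
From mathcomp Require Import all_boot all_order all_algebra.
From mathcomp Require Import all_classical all_reals convex.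

Set Implicit Arguments.
Unset Strict Implicit.
Unset Printing Implicit Defensive.

Import Order.TTheory GRing.Theory Num.Theory.
Local Open Scope classical_set_scope.
Local Open Scope ring_scope.

Section Polytopes.
Context {R : realType} {E : vectType R}.

Definition convex_hull (S : set E) : set E := smallest (@convex_set R E) S.

Definition affine_hull (S : set E) : set E :=
  [set x | exists (k : nat) (p : 'I_k -> E) (a : 'I_k -> R),
     [/\ forall i, S (p i), \sum_(i < k) a i = 1 & x = \sum_(i < k) a i *: p i]].

(* The dimension of S is that of its affine hull, a translate of a linear
   subspace.  The empty set has no dimension: its affine hull is empty. *)
Definition has_affine_dim (S : set E) (d : nat) : Prop :=
  exists (x0 : E) (V : {vspace E}),
    affine_hull S = [set x | x - x0 \in V] /\ \dim V = d.

(* F is cut out of P by an inequality f x <= c valid on P.  The trivial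
   inequalities 0 <= 0 and 0 <= 1 give F = P and F = set0 respectively. *)
Definition is_face (P F : set E) : Prop :=
  exists (f : {linear E -> R^o}) (c : R),
    (forall x, P x -> f x <= c) /\ F = [set x | P x /\ f x = c].

(* The empty face is never a facet, since has_affine_dim fails for it.  This
   matters only when P is a point, which accordingly has no facets. *)
Definition facets (P : set E) : set (set E) :=
  [set F | is_face P F /\
           exists d, has_affine_dim P d.+1 /\ has_affine_dim F d].

End Polytopes.

(* An element (i, m) of [position n] is the position of the entry b_{i,m};
   writing m = n - j, the condition reads 1 <= j <= i <= n - 1. *)
Definition position (n : nat) : finType :=
  {p : 'I_n * 'I_n | (1 <= n - p.2 <= p.1)%N}.

Definition row_of n (p : position n) : nat := (val p).1.
Definition col_of n (p : position n) : nat := (val p).2.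

(* The sum of the b_{k,m} over the rows lo <= k <= hi. *)
Definition col_sum n (b : {ffun position n -> bool}) (m lo hi : nat) : nat :=
  (\sum_(p : position n | (col_of p == m) && (lo <= row_of p <= hi)) b p)%N.

Definition is_TSSCPP_triangle n (b : {ffun position n -> bool}) : Prop :=
  forall i j : nat, (1 <= j)%N -> (j < i)%N -> (i <= n - 1)%N ->
    (col_sum b (n - j) j i <= 1 + col_sum b (n - j - 1) j.+1 i)%N.

Definition triangle_point (R : realType) n (b : {ffun position n -> bool}) :
    {ffun position n -> R^o} :=
  [ffun p => (b p)%:R : R^o].

Definition BTP (R : realType) (n : nat) : set {ffun position n -> R^o} :=
  convex_hull (@triangle_point R n @` [set b | is_TSSCPP_triangle b]).
Arguments BTP R n : clear implicits.

(* Main.v *)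
Require Import Defs.
From HB Require Import structures.
From mathcomp Require Import all_boot all_order all_algebra zify lra.
From mathcomp Require Import all_classical all_reals convex.

(** The partial column sums turn the inequalities [0 <= b_p <= 1] and the
triangle inequalities into difference constraints, so rounding the partial
sums of an integer point [z] of the [N]-fold dilate, [(sum + j) %/ N] for
[j < N], gives [N] triangles, which add up to [z] by Hermite's identity.

Each inequality is a facet: on the triangles where it is tight, adding or
exchanging entries produces every direction of the hyperplane.  The exception
is the triangle inequality at the first entry of a column, which follows from
[b_p <= 1].  Conversely, suppose that the maximizers of a functional [f] lie on
none of these facets.  Adding up one maximizer off each of them gives an integer
point of a dilate which can be moved by one unit along each axis in both
directions, so decomposing into triangles shows [f = 0].  Counting the
inequalities gives [2 C(n,2) + C(n-1,2)]. *)

(** * Partial column sums and integer points of dilates *)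

Section Triangles.
Variable n : nat.
Implicit Types (p q r : position n) (z : position n -> nat).

(** Column [m] begins in row [n - m], which is the index [j] of the triangle inequality, so this is
    the condition [j < i]. *)
Definition nonfirst p := n - col_of p < row_of p.

(* Column [m] has no entry above row [n - m], so no lower bound on the row is
   needed. *)
Definition csum z m i :=
  \sum_(p : position n | (col_of p == m) && (row_of p <= i)) z p.

Definition feasible N z :=
  (forall p, z p <= N) /\
  forall p, nonfirst p ->
    csum z (col_of p) (row_of p) <= N + csum z (col_of p).-1 (row_of p).

Lemma position_bounds p :
  [/\ n - col_of p <= row_of p, row_of p < n & 0 < col_of p < n].
Proof.
rewrite /row_of /col_of; case: p => -[[i ltin] [m ltmn]] /= /andP[_ h].
by split=> //; lia.
Qed.

Lemma position_inj p q : row_of p = row_of q -> col_of p = col_of q -> p = q.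
Proof.
move=> hr hc; apply: val_inj; rewrite [LHS]surjective_pairing.
by rewrite [RHS]surjective_pairing; congr pair; apply: val_inj.
Qed.

Lemma position_exists i m : i < n -> m < n -> n - m <= i ->
  exists p, row_of p = i /\ col_of p = m.
Proof.
move=> ltin ltmn le_i.
have h : 1 <= n - (Ordinal ltin, Ordinal ltmn).2 <= (Ordinal ltin, Ordinal ltmn).1.
  by rewrite /= subn_gt0 ltmn.
by exists (exist _ (Ordinal ltin, Ordinal ltmn) h).
Qed.

Lemma csum0 z m : csum z m 0 = 0.
Proof.
by apply: big1 => p /andP[_ h]; have [] := position_bounds p; lia.
Qed.

Lemma csum_at z p :
  csum z (col_of p) (row_of p) = csum z (col_of p) (row_of p).-1 + z p.
Proof.
have [h _ hc] := position_bounds p.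
rewrite /csum (bigD1 p) ?eqxx ?leqnn //= addnC; congr (_ + _).
apply: eq_bigl => q; case: eqVneq => //= hq.
have [->|neq] := eqVneq q p; first by lia.
suff : row_of q <> row_of p by lia.
by move=> hr; case/eqP: neq; apply: position_inj.
Qed.

(** Supports induction on the row over all of [nat]: passing to the next row either meets an entry
    of the column or leaves every partial sum unchanged. *)
Variant row_spec (m i : nat) : Type :=
| RowIn p of m = col_of p & i.+1 = row_of p
| RowOut of (forall z, csum z m i.+1 = csum z m i).

Lemma rowP m i : row_spec m i.
Proof.
case: (pickP (fun p => (col_of p == m) && (row_of p == i.+1))) => [p|none].
  by case/andP=> /eqP hc /eqP hr; apply: (@RowIn m i p).
apply: RowOut => z; apply: eq_bigl => q; have := none q.
by case: eqVneq => //= _; lia.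
Qed.

Lemma csumS z m i : csum z m i <= csum z m i.+1.
Proof.
case: (rowP m i) => [p hc hr|-> //].
by rewrite hc hr csum_at -hr leq_addr.
Qed.

Lemma csum_small z m i : i < n - m -> csum z m i = 0.
Proof.
move=> lt_i; apply: big1 => p /andP[/eqP hc h].
by have [] := position_bounds p; rewrite hc; lia.
Qed.

(** Where column [m.+1] has no entry, its sum stays constant while the other side cannot decrease.
    At its first entry the sum is that single entry, hence at most [N]. *)
Lemma feasible_csum N z : feasible N z ->
  forall m i, csum z m.+1 i <= N + csum z m i.
Proof.
move=> [leN H] m; elim=> [|i IH]; first by rewrite csum0.
case: (rowP m.+1 i) => [p hc hr|->]; last first.
  by rewrite (leq_trans IH) // leq_add2l csumS.
have [nf|] := boolP (nonfirst p).
  by have := H p nf; rewrite -hc -hr.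
rewrite /nonfirst -leqNgt => first_p.
rewrite hc hr csum_at -hr -hc csum_small ?add0n; last first.
  by rewrite hc hr in first_p *; have [] := position_bounds p; lia.
by rewrite (leq_trans (leN p)) // leq_addr.
Qed.

Lemma feasibleP N z : (forall p, z p <= N) ->
  (forall m i, csum z m.+1 i <= N + csum z m i) -> feasible N z.
Proof.
move=> leN H; split=> // p _; have [_ _ /andP[hc _]] := position_bounds p.
by rewrite -{1}(prednK hc).
Qed.

Lemma col_sumE (b : {ffun position n -> bool}) m lo hi : lo <= n - m ->
  col_sum b m lo hi = csum (fun p => b p) m hi.
Proof.
move=> le_lo; apply: eq_bigl => p; case: eqVneq => //= hc.
by have [] := position_bounds p; rewrite hc; lia.
Qed.

(** The lower summation limits [j] and [j.+1] are the first rows of columns [n - j] and [n - j - 1],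
    so both sides are partial sums of whole columns. *)
Lemma TSSCPP_feasible (b : {ffun position n -> bool}) :
  is_TSSCPP_triangle b <-> feasible 1 (fun p => b p).
Proof.
split=> [H|/feasible_csum H i j j1 ltji lei].
  split=> [p|p nf]; first exact: leq_b1.
  have [_ ltrn /andP[hc hcn]] := position_bounds p.
  have hj : n - (n - col_of p) = col_of p by lia.
  have := H (row_of p) (n - col_of p).
  rewrite !col_sumE ?hj ?subn1; try lia.
  by apply => //; move: nf; rewrite /nonfirst; lia.
rewrite !col_sumE; try lia.
set m := n - j - 1; have -> : n - j = m.+1 by lia.
exact: H.
Qed.

(** * Decomposition of an integer point of a dilate into triangles *)

Definition slice N z (j : nat) p : nat :=
  (csum z (col_of p) (row_of p) + j) %/ N
    - (csum z (col_of p) (row_of p).-1 + j) %/ N.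

(** The increments telescope down the column; their truncated subtraction is exact because partial
    sums are nondecreasing in the row. *)
Lemma csum_slice N z j m i : j < N ->
  csum (slice N z j) m i = (csum z m i + j) %/ N.
Proof.
move=> ltjN; elim: i => [|i IH]; first by rewrite !csum0 divn_small.
case: (rowP m i) => [p hc hr|E]; last by rewrite !E.
rewrite {1}hc {1}hr csum_at -hr -hc /= IH /slice -hc -hr subnKC //.
by rewrite leq_div2r // leq_add2r csumS.
Qed.

Lemma divn_addl N a : 0 < N -> (N + a) %/ N = (a %/ N).+1.
Proof. by move=> N0; rewrite divnDl // divnn N0. Qed.

(** Floor division by [N] is monotone and turns an added [N] into an added 1, so it carries each
    inequality with slack [N] to the one with slack 1. *)
Lemma feasible_slice N z j : j < N -> feasible N z -> feasible 1 (slice N z j).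
Proof.
move=> ltjN fz; have N0 : 0 < N by lia.
apply: feasibleP => [p|m i].
  rewrite /slice csum_at leq_subLR addn1 -divn_addl // leq_div2r //.
  by have := fz.1 p; lia.
rewrite !csum_slice // add1n -divn_addl // leq_div2r //.
by have := feasible_csum _ _ fz m i; lia.
Qed.

(** Raising [a] by one shifts the window of numerators: [a] leaves and [a + N] enters, whose
    quotient is larger by one. *)
Lemma sum_divn_shift N a : 0 < N -> \sum_(j < N) (a + j) %/ N = a.
Proof.
move=> N0; elim: a => [|a IH].
  by apply: big1 => j _; rewrite add0n divn_small.
under eq_bigr do rewrite addSnnS.
case: N N0 IH => // N N0; rewrite big_ord_recl big_ord_recr /= addn0 => IH.
by rewrite addnC [a + N.+1]addnC divn_addl // addSn IH.
Qed.

Lemma sum_slice N z p : 0 < N -> \sum_(j < N) slice N z j p = z p.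
Proof.
move=> N0; rewrite /slice sumnB; last first.
  by move=> j _; rewrite leq_div2r // leq_add2r csum_at leq_addr.
by rewrite !sum_divn_shift // csum_at addKn.
Qed.

(** * Triangles with at most three entries equal to one *)

Lemma csumD z1 z2 m i :
  csum (fun p => z1 p + z2 p) m i = csum z1 m i + csum z2 m i.
Proof. exact: big_split. Qed.

Lemma csum_unit q m i :
  csum (fun p => p == q) m i = (col_of q == m) && (row_of q <= i).
Proof.
rewrite /csum; have [h|/negbTE h] := boolP (_ && _).
  rewrite (bigD1 q) //= eqxx big1 ?addn0 // => p /andP[_ /negbTE ->] //.
by rewrite big1 // => p; case: (eqVneq p q) => // ->; rewrite h.
Qed.

Lemma feasible0 : feasible 1 (fun=> 0).
Proof. by apply: feasibleP => // m i; rewrite /csum big1. Qed.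

Lemma feasible1 q : feasible 1 (fun p => p == q).
Proof.
apply: feasibleP => [p|m i]; first exact: leq_b1.
by rewrite csum_unit (leq_trans (leq_b1 _)) ?leq_addr.
Qed.

Lemma feasible2 q1 q2 : col_of q1 != col_of q2 ->
  feasible 1 (fun p => (p == q1) + (p == q2)).
Proof.
move=> neq; apply: feasibleP => [p|m i].
  have : q1 != q2 by apply: contraNneq neq => ->.
  by case: (eqVneq p q1) => [-> /negbTE ->|_ _] //; rewrite leq_b1.
by rewrite !csumD !csum_unit; move: neq; lia.
Qed.

(** Once the sum of the column of [q1] reaches 2, at row [row_of q2], the entry [q3] of the
    preceding column has already been counted. *)
Lemma feasible3 q1 q2 q3 : col_of q1 = col_of q2 -> row_of q1 < row_of q2 ->
  col_of q1 = (col_of q3).+1 -> row_of q3 <= row_of q2 ->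
  feasible 1 (fun p => (p == q1) + (p == q2) + (p == q3)).
Proof.
move=> h12 r12 h13 r32; apply: feasibleP => [p|m i].
  have n12 : q1 != q2 by apply: contraTneq r12 => ->; rewrite ltnn.
  have n13 : q1 != q3 by apply/eqP => e; move: h13; rewrite e; lia.
  have n23 : q2 != q3 by apply/eqP => e; move: h13; rewrite h12 e; lia.
  have [->|_] := eqVneq p q1; first by rewrite (negbTE n12) (negbTE n13).
  by have [->|_] := eqVneq p q2; rewrite ?(negbTE n23) // leq_b1.
by rewrite !csumD !csum_unit; lia.
Qed.

End Triangles.

(** * Affine hulls, and recognizing the facets in a list of hyperplanes *)

Section AffineHull.
Import Order.TTheory GRing.Theory Num.Theory.
Local Open Scope classical_set_scope.
Local Open Scope ring_scope.
Variables (R : realType) (E : vectType R).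
Implicit Types (S T P F : set E) (x s t u : E).

Lemma sub_affine_hull S : S `<=` affine_hull S.
Proof.
move=> x Sx; exists 1%N, (fun=> x), (fun=> 1); split=> //.
  by rewrite big_ord1.
by rewrite big_ord1 scale1r.
Qed.

Lemma affine_hullS S T : S `<=` T -> affine_hull S `<=` affine_hull T.
Proof.
move=> ST x [k [p [a [Sp ? ?]]]]; exists k, p, a; split=> // i; exact: ST.
Qed.

Lemma affine_hull_level S (f : {linear E -> R^o}) (c : R) :
  (forall x, S x -> f x = c) -> forall x, affine_hull S x -> f x = c.
Proof.
move=> Sc x [k [p [a [Sp a1 ->]]]].
rewrite linear_sum; under eq_bigr do rewrite linearZ (Sc _ (Sp _)).
by rewrite -mulr_suml a1 mul1r.
Qed.

(** Invariance of the hull needs no base point. Every vector qualifies when [S] is empty, so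
    dimensions are computed from directions together with a point of [S]. *)
Definition direction S u := forall x (a : R),
  affine_hull S x -> affine_hull S (x + a *: u).

(** Adjoining [s] and [t] with weights [a] and [- a] to an affine combination keeps the total weight
    1. *)
Lemma directionB S s t : S s -> S t -> direction S (s - t).
Proof.
move=> Ss St x a [k [p [b [Sp b1 ->]]]].
pose ext (T : Type) (y z : T) (h : 'I_k -> T) (i : 'I_k.+2) :=
  if unlift ord0 i is Some j then
    if unlift ord0 j is Some l then h l else z
  else y.
exists k.+2, (ext _ s t p), (ext _ a (- a) b); split.
- move=> i; rewrite /ext; case: unliftP => [j _|_] //.
  by case: unliftP.
- rewrite !big_ord_recl /ext unlift_none liftK unlift_none addrA subrr add0r.
  by rewrite -b1; apply: eq_bigr => i _; rewrite !liftK.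
- rewrite !big_ord_recl /ext unlift_none liftK unlift_none addrA.
  rewrite scalerBr -scaleNr addrC; congr (_ + _).
  by apply: eq_bigr => i _; rewrite !liftK.
Qed.

Lemma directionZ S (b : R) u : direction S u -> direction S (b *: u).
Proof. by move=> Du x a Sx; rewrite scalerA; apply: Du. Qed.

Lemma directionD S u v : direction S u -> direction S v -> direction S (u + v).
Proof. by move=> Du Dv x a Sx; rewrite scalerDr addrA; apply/Dv/Du. Qed.

Lemma direction_sum S (I : finType) (u : I -> E) :
  (forall i, direction S (u i)) -> direction S (\sum_i u i).
Proof.
move=> Du; apply: big_ind => [x a Sx||i _]; last exact: Du.
  by rewrite scaler0 addr0.
exact: directionD.
Qed.

Lemma translate_subset x y (V W : {vspace E}) :
  [set z | z - x \in V] `<=` [set z | z - y \in W] ->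
  x - y \in W /\ (V <= W)%VS.
Proof.
move=> sub; have xy : x - y \in W by apply: sub; rewrite /= subrr mem0v.
split=> //; apply/subvP => v vV.
have : x + v - y \in W by apply: sub; rewrite /= addrAC subrr add0r.
by rewrite addrAC => h; rewrite -(addKr (x - y) v) rpredD // rpredN.
Qed.

Lemma affine_dim_le S T d e : S `<=` T ->
  has_affine_dim S d -> has_affine_dim T e -> (d <= e)%N.
Proof.
move=> ST [x [V [hS <-]]] [y [W [hT <-]]]; apply: dimvS.
have := affine_hullS _ _ ST; rewrite hS hT.
by case/translate_subset.
Qed.

Lemma affine_hull_eq S T d : S `<=` T ->
  has_affine_dim S d -> has_affine_dim T d -> affine_hull S = affine_hull T.
Proof.
move=> ST [x [V [hS dV]]] [y [W [hT dW]]].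
have hST := affine_hullS _ _ ST; rewrite hS hT in hST *.
have [xy VW] := translate_subset _ _ _ _ hST.
have /eqP eqVW : V == W by rewrite eqEdim VW dV dW /=.
apply/seteqP; split=> // z /= h.
by rewrite -(subrKA y) eqVW rpredD // -opprB rpredN.
Qed.

Lemma affine_dim_full S x : S x -> (forall u, direction S u) ->
  has_affine_dim S (\dim {:E}).
Proof.
move=> Sx DS; exists 0, fullv; split=> //; apply/seteqP; split=> y /= _.
  by rewrite memvf.
by have := DS (y - x) x 1 (sub_affine_hull _ _ Sx); rewrite scale1r subrKC.
Qed.

Lemma affine_hull_hyperplane S (f : {linear E -> R^o}) (c : R) x :
  (forall s, S s -> f s = c) -> S x ->
  (forall u, f u = 0 -> direction S u) ->
  affine_hull S = [set y | f y = c].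
Proof.
move=> fS Sx DS; apply/seteqP; split=> y /=; first exact: affine_hull_level.
move=> fy; have f0 : f (y - x) = 0 by rewrite linearB fy (fS x Sx) subrr.
by have := DS _ f0 x 1 (sub_affine_hull _ _ Sx); rewrite scale1r subrKC.
Qed.

Lemma affine_dim_hyperplane S (f : {linear E -> R^o}) (c : R) w :
  affine_hull S = [set y | f y = c] -> f w != 0 ->
  exists d, has_affine_dim S d /\ d.+1 = \dim {:E}.
Proof.
move=> hS fw; exists (\dim (lker (linfun f))); split.
  exists ((c / f w) *: w), (lker (linfun f)); split=> //; rewrite hS.
  apply/seteqP; split=> y /=; rewrite memv_ker lfunE /= linearB linearZ /=.
    by move=> ->; rewrite /GRing.scale /= divfK // subrr.
  by rewrite subr_eq0 => /eqP ->; rewrite /GRing.scale /= divfK.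
(* Rank-nullity: the image of [f] is nonzero since [f w != 0], hence one-dimensional. *)
rewrite -(limg_ker_dim (linfun f) fullv) capfv -addn1; congr addn.
apply/eqP; rewrite eqn_leq; apply/andP; split.
  rewrite lt0n dimv_eq0; apply: contra fw => /eqP h.
  by have := memv_img (linfun f) (memvf w); rewrite h memv0 lfunE.
by rewrite (leq_trans (dimvS (subvf _))) // dimvf.
Qed.

(** If a facet lies in the face of some [g k], both have the same dimension, so their affine hulls
    agree and [f = b] on the whole face. Otherwise the last hypothesis gives [f = 0], and the facet
    would be all of [P], of larger dimension. *)
Lemma facets_hyperplanes P (K : finType) (g : K -> {linear E -> R^o})
    (c : K -> R) :
  (forall k x, P x -> g k x <= c k) ->
  has_affine_dim P (\dim {:E}) ->
  (forall k, affine_hull [set x | P x /\ g k x = c k] = [set x | g k x = c k]) ->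
  (forall k, exists w, g k w != 0) ->
  (forall (f : {linear E -> R^o}) (b : R), (forall x, P x -> f x <= b) ->
     (forall k, exists2 x, P x & f x = b /\ g k x != c k) ->
     forall x, f x = 0) ->
  facets P = range (fun k => [set x | P x /\ g k x = c k]).
Proof.
move=> valid dimP affG gn0 interior.
apply/seteqP; split=> [F|_ [k _ <-]]; last first.
  split; first by exists (g k), (c k); split=> // x; apply: valid.
  have [w gw] := gn0 k.
  have [d [dG dE]] := affine_dim_hyperplane _ _ _ _ (affG k) gw.
  by exists d; rewrite dE.
move=> [[f [b [fb ->]]] [d [dP dF]]].
have dE : d.+1 = \dim {:E}.
  by apply/eqP; rewrite eqn_leq !(affine_dim_le P P).
have [[k Fk]|noK] := pselect (exists k, forall x, P x -> f x = b -> g k x = c k).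
  exists k => //; have [w gw] := gn0 k.
  have [d' [dG dE']] := affine_dim_hyperplane _ _ _ _ (affG k) gw.
  have eqd : d' = d by move: dE'; rewrite -dE => -[].
  rewrite eqd in dG.
  have FG : [set x | P x /\ f x = b] `<=` [set x | P x /\ g k x = c k].
    by move=> x [Px fx]; split=> //; apply: Fk.
  have affE := affine_hull_eq _ _ _ FG dF dG.
  apply/seteqP; split=> [x [Px gx]|//]; split=> //.
  apply: (@affine_hull_level [set x | P x /\ f x = b]); first by move=> y [].
  by rewrite affE; apply: sub_affine_hull.
have f0 : forall x, f x = 0.
  apply: (interior f b fb) => k; apply: contrapT => h; apply: noK; exists k.
  move=> x Px fx; apply/eqP/negPn/negP => gx; apply: h; by exists x.
have FP : [set x | P x /\ f x = b] = P.
  have [x0 [V [hF _]]] := dF.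
  have [y [k [p [a [Sp a1 _]]]]] : affine_hull [set x | P x /\ f x = b] !=set0.
    by exists x0; rewrite hF /= subrr mem0v.
  (* The hull of the facet is nonempty and weights summing to 1 cannot form an empty family, so the
     facet contains a point; there [f = 0] is [b]. *)
  have b0 : b = 0.
    case: k p a Sp a1 => [|k] p a Sp a1.
      by move: a1; rewrite big_ord0 => /esym/eqP; rewrite oner_eq0.
    by have [_ <-] := Sp ord0.
  by apply/seteqP; split=> [x []//|x Px]; split=> //; rewrite f0.
rewrite FP in dF; have := affine_dim_le _ _ _ _ (@subset_refl _ P) dP dF.
by rewrite ltnn.
Qed.

End AffineHull.

(** * The polytope and its candidate facets *)

Section Facets.
Import Order.TTheory GRing.Theory Num.Theory.
Local Open Scope classical_set_scope.
Local Open Scope ring_scope.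
Variables (R : realType) (n : nat).
Local Notation E := {ffun position n -> R^o}.
Implicit Types (p q r : position n) (z : position n -> nat) (x u : E).

Definition point z : E := [ffun p => (z p)%:R].

Lemma pointD z1 z2 : point (fun p => z1 p + z2 p)%N = point z1 + point z2.
Proof. by apply/ffunP => p; rewrite !ffunE natrD. Qed.

Lemma point_sum (I : finType) (z : I -> position n -> nat) :
  point (fun p => \sum_i z i p)%N = \sum_i point (z i).
Proof.
apply/ffunP => p; rewrite sum_ffunE ffunE natr_sum.
by apply: eq_bigr => i _; rewrite ffunE.
Qed.

Local Notation unit q := (point (fun p => (p == q : nat))).

Lemma sum_unit x : x = \sum_q x q *: unit q.
Proof.
apply/ffunP => p; rewrite sum_ffunE (bigD1 p) //= big1 => [|q /negbTE neq].
  by rewrite !ffunE eqxx addr0 /GRing.scale /= mulr1.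
by rewrite !ffunE eq_sym neq /GRing.scale /= mulr0.
Qed.

Lemma point_triangle (b : {ffun position n -> bool}) :
  triangle_point R b = point (fun p => b p).
Proof. by apply/ffunP => p; rewrite !ffunE. Qed.

Lemma BTP_point z : feasible n 1 z -> BTP R n (point z).
Proof.
move=> fz; apply: sub_gen_smallest; exists [ffun p => z p == 1%N].
  apply/TSSCPP_feasible; rewrite (_ : (fun _ => _) = z) //.
  by apply/funext => p; rewrite ffunE; have := fz.1 p; case: (z p) => [|[]].
rewrite point_triangle; congr point; apply/funext => p; rewrite ffunE.
by have := fz.1 p; case: (z p) => [|[]].
Qed.

Lemma BTP_ind (Q : set E) :
  (forall z, feasible n 1 z -> Q (point z)) ->
  (forall x y (a : R), 0 < a -> a < 1 -> Q x -> Q y -> Q (a *: x + (1 - a) *: y)) ->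
  BTP R n `<=` Q.
Proof.
move=> Qz Qconv x; apply; split.
  apply/convex_setW => y y' yQ y'Q k k0 k1; rewrite inE; rewrite !inE in yQ y'Q.
  exact: Qconv.
by move=> _ [b /TSSCPP_feasible tb <-]; rewrite point_triangle; apply: Qz.
Qed.

Definition dot (a : position n -> R) (x : E) : R^o := \sum_p a p * x p.

Lemma dot_is_linear a : linear (dot a).
Proof.
move=> b x y; rewrite /dot scaler_sumr -big_split; apply: eq_bigr => p _.
by rewrite !ffunE mulrDr /GRing.scale /= mulrCA.
Qed.

HB.instance Definition _ a :=
  GRing.isLinear.Build R E R^o *:%R (dot a) (dot_is_linear a).

Lemma dot_unit a q : dot a (unit q) = a q.
Proof.
rewrite /dot (bigD1 q) //= big1 => [|p /negbTE neq]; rewrite ffunE.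
  by rewrite eqxx mulr1 addr0.
by rewrite neq mulr0.
Qed.

(** Expanding [u] in unit vectors, the corrections add up to [dot a u *: w], which vanishes. *)
Lemma kernel_direction (S : set E) (a : position n -> R) (w : E) :
  (forall q, direction R E S (unit q - a q *: w)) ->
  forall u, dot a u = 0 -> direction R E S u.
Proof.
move=> DS u au.
suff -> : u = \sum_q u q *: (unit q - a q *: w).
  by apply: direction_sum => q; apply/directionZ/DS.
under eq_bigr do rewrite scalerBr scalerA.
rewrite sumrB -sum_unit -scaler_suml.
under eq_bigr do rewrite mulrC.
by rewrite -[X in X *: _]/(dot a u) au scale0r subr0.
Qed.

(* The inequalities [b_p >= 0], [b_p <= 1] and the triangle inequality at [p]. *)
Definition facet_index : finType :=
  (position n + position n + {p | nonfirst n p})%type.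
Implicit Type k : facet_index.

Definition coef k p : R :=
  match k with
  | inl (inl q) => - (p == q)%:R
  | inl (inr q) => (p == q)%:R
  | inr (exist q _) => ((col_of p == col_of q) && (row_of p <= row_of q)%N)%:R
      - ((col_of p == (col_of q).-1) && (row_of p <= row_of q)%N)%:R
  end.

Definition bound k : R := if k is inl (inl _) then 0 else 1.

Definition tight k z : bool :=
  match k with
  | inl (inl q) => z q == 0%N
  | inl (inr q) => z q == 1%N
  | inr (exist q _) => csum n z (col_of q) (row_of q)
                         == (csum n z (col_of q).-1 (row_of q)).+1
  end.

Lemma dot_pred1 q z : dot (fun p => (p == q)%:R) (point z) = (z q)%:R.
Proof.
rewrite /dot (bigD1 q) //= big1 => [|p /negbTE ->]; rewrite ?mul0r //.
by rewrite eqxx mul1r addr0 ffunE.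
Qed.

Lemma dot_csum m i z :
  dot (fun p => ((col_of p == m) && (row_of p <= i)%N)%:R) (point z)
    = (csum n z m i)%:R.
Proof.
rewrite /dot /csum natr_sum [RHS]big_mkcond; apply: eq_bigr => p _.
by rewrite ffunE; case: ifP => _; rewrite ?mul1r ?mul0r.
Qed.

Lemma dotN a x : dot (fun p => - a p) x = - dot a x.
Proof. by rewrite /dot -sumrN; apply: eq_bigr => p _; rewrite mulNr. Qed.

Lemma dotB a a' x : dot (fun p => a p - a' p) x = dot a x - dot a' x.
Proof. by rewrite /dot -sumrB; apply: eq_bigr => p _; rewrite mulrBl. Qed.

Lemma dot_coef k z : dot (coef k) (point z) =
  match k with
  | inl (inl q) => - (z q)%:R
  | inl (inr q) => (z q)%:R
  | inr (exist q _) => (csum n z (col_of q) (row_of q))%:R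
                         - (csum n z (col_of q).-1 (row_of q))%:R
  end.
Proof.
case: k => [[q|q]|[q nf]] /=.
- by rewrite dotN dot_pred1.
- exact: dot_pred1.
- by rewrite dotB !dot_csum.
Qed.

Lemma dot_coef_le k z : feasible n 1 z -> dot (coef k) (point z) <= bound k.
Proof.
move=> [z1 fz]; rewrite dot_coef; case: k => [[q|q]|[q nf]] /=.
- by rewrite oppr_le0 ler0n.
- by rewrite lern1.
- by rewrite lerBlDr nat1r ler_nat fz.
Qed.

Lemma tightP k z : reflect (dot (coef k) (point z) = bound k) (tight k z).
Proof.
rewrite dot_coef; apply: (iffP idP); case: k => [[q|q]|[q nf]] /=.
- by move=> /eqP ->; rewrite oppr0.
- by move=> /eqP ->.
- by move=> /eqP ->; rewrite -natr1 addrAC subrr add0r.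
- by move/eqP; rewrite oppr_eq0 pnatr_eq0.
- by move/eqP; rewrite pnatr_eq1.
- by move/eqP; rewrite subr_eq nat1r eqr_nat.
Qed.

Definition facet k : set E := [set x | BTP R n x /\ dot (coef k) x = bound k].

Lemma facet_point k z : feasible n 1 z -> (facet k (point z) <-> tight k z).
Proof.
move=> fz; split=> [[_ /tightP]//|tz]; split; first exact: BTP_point.
exact/tightP.
Qed.

(** * Each inequality spans its hyperplane *)

Lemma direction_pair k z q : feasible n 1 z ->
  feasible n 1 (fun p => z p + (p == q))%N -> tight k z ->
  tight k (fun p => z p + (p == q))%N -> direction R E (facet k) (unit q).
Proof.
move=> fz fzq tz tzq.
have -> : unit q = point (fun p => z p + (p == q))%N - point z.
  by rewrite pointD addrAC subrr add0r.
by apply: directionB; apply/facet_point.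
Qed.

Lemma direction_lower p q : p != q ->
  direction R E (facet (inl (inl p))) (unit q).
Proof.
move=> neq; apply: (direction_pair _ (fun=> 0%N)) => //=.
- exact: feasible0.
- exact: feasible1.
- by rewrite (negbTE neq).
Qed.

Lemma direction_upper p q : p != q ->
  direction R E (facet (inl (inr p))) (unit q).
Proof.
move=> neq; have [hc|hc] := eqVneq (col_of p) (col_of q); last first.
  apply: (direction_pair _ (fun r => r == p : nat)) => /=.
  - exact: feasible1.
  - exact: feasible2.
  - by rewrite eqxx.
  - by rewrite eqxx (negbTE neq).
have neqr : row_of p <> row_of q.
  by move=> hr; case/eqP: neq; apply: position_inj.
have [p1 p2 /andP[p3 p4]] := position_bounds n p.
have [q1 q2 _] := position_bounds n q.
(* Having both [p] and [q] in one column requires an entry in the preceding column; the larger row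
   works whichever of the two comes first. *)
have [|||r [hr hcr]] := position_exists n (maxn (row_of p) (row_of q)) (col_of p).-1.
- by rewrite gtn_max p2.
- by lia.
- by lia.
have neqcr : col_of p != col_of r by lia.
have neqpr : p != r by apply: contraNneq neqcr => ->.
apply: (direction_pair _ (fun s => (s == p) + (s == r))%N) => /=.
- exact: feasible2.
- have [lt|ge] := ltnP (row_of p) (row_of q).
    rewrite (_ : (fun s => _) = (fun s => (s == p) + (s == q) + (s == r))%N).
      by apply: feasible3; lia.
    by apply/funext => s; rewrite addnAC.
  rewrite (_ : (fun s => _) = (fun s => (s == q) + (s == p) + (s == r))%N).
    by apply: feasible3; lia.
  by apply/funext => s; rewrite addnAC [X in (X + _)%N]addnC.
- by rewrite eqxx (negbTE neqpr).
- by rewrite eqxx (negbTE neq) (negbTE neqpr).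
Qed.

(** Take [r] to be the first entry of the column of [p], where the coefficient is 1. Entries of
    coefficient 1 are exchanged with [r], those of coefficient -1 are added together with [r], and
    those of coefficient 0 are added to a tight triangle containing [r]. *)
Lemma direction_partial p (nf : nonfirst n p) : exists r, forall q,
  direction R E (facet (inr (exist _ p nf)))
    (unit q - coef (inr (exist _ p nf)) q *: unit r).
Proof.
set k := inr _; have [p1 p2 /andP[p3 p4]] := position_bounds n p.
have p0 := nf; rewrite /nonfirst in p0.
have [|||r [hr hcr]] := position_exists n (n - col_of p) (col_of p); try lia.
have tS z : tight k z = (csum n z (col_of p) (row_of p)
                         == (csum n z (col_of p).-1 (row_of p)).+1) by [].
exists r => q; have [q1 q2 /andP[q3 q4]] := position_bounds n q.
have [hq|hq] := eqVneq (col_of q) (col_of p).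
  have [le|lt] := leqP (row_of q) (row_of p).
    have -> : coef k q = 1 by rewrite /= hq eqxx le gtn_eqF ?subr0 //; lia.
    rewrite scale1r; apply: directionB; apply/facet_point; try exact: feasible1.
      by rewrite tS !csum_unit; lia.
    by rewrite tS !csum_unit; lia.
  have -> : coef k q = 0 by rewrite /= (leqNgt (row_of q)) lt !andbF subr0.
  rewrite scale0r subr0.
  (* Placed in row [row_of q], below [p], the entry [s] permits adding [q] without entering either
     sum of the inequality at [p]. *)
  have [|||s [hs hcs]] := position_exists n (row_of q) (col_of p).-1; try lia.
  apply: (direction_pair _ (fun t => (t == r) + (t == s))%N).
  - by apply: feasible2; lia.
  - rewrite (_ : (fun t => _) = (fun t => (t == r) + (t == q) + (t == s))%N).
      by apply: feasible3; lia.
    by apply/funext => t; rewrite addnAC.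
  - by rewrite tS !csumD !csum_unit; lia.
  - by rewrite tS !csumD !csum_unit; lia.
have [/andP[/eqP hq' le]|irr] :=
  boolP ((col_of q == (col_of p).-1) && (row_of q <= row_of p)%N).
  have -> : coef k q = -1 by rewrite /= (negbTE hq) hq' eqxx le sub0r.
  (* Both [r], [s], [q] together and [s] alone are tight triangles; their difference is the wanted
     sum of the units at [q] and [r]. *)
  have [|||s [hs hcs]] := position_exists n (row_of q) (col_of p); try lia.
  have -> : unit q - -1 *: unit r =
      point (fun t => (t == r) + (t == s) + (t == q))%N - unit s.
    by rewrite !pointD scaleN1r opprK addrAC addrK addrC.
  apply: directionB; apply/facet_point; try exact: feasible1.
  - by apply: feasible3; lia.
  - by rewrite tS !csumD !csum_unit; lia.
  - by rewrite tS !csum_unit; lia.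
have -> : coef k q = 0 by rewrite /= (negbTE hq) (negbTE irr) subr0.
rewrite scale0r subr0; apply: (direction_pair _ (fun t => t == r : nat)).
- exact: feasible1.
- by apply: feasible2; lia.
- by rewrite tS !csum_unit; lia.
- by rewrite tS !csumD !csum_unit; lia.
Qed.

Lemma facet_kernel k u : dot (coef k) u = 0 -> direction R E (facet k) u.
Proof.
move: u; have dir0 u : u = 0 -> direction R E (facet k) u.
  by move=> -> x a hx; rewrite scaler0 addr0.
case: k dir0 => [[p|p]|[p nf]] dir0.
(* In both bound cases [w] has value 1 under [dot (coef k)], so the vector attached to [p] itself is
   zero. *)
- apply: (kernel_direction _ _ (- unit p)) => q /=.
  have [->|neq] := eqVneq q p.
    by apply: dir0; rewrite scaleNr scalerN opprK scale1r subrr.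
  by rewrite oppr0 scale0r subr0; apply: direction_lower; rewrite eq_sym.
- apply: (kernel_direction _ _ (unit p)) => q /=.
  have [->|neq] := eqVneq q p; first by apply: dir0; rewrite scale1r subrr.
  by rewrite scale0r subr0; apply: direction_upper; rewrite eq_sym.
- by have [r Dr] := direction_partial p nf; apply: kernel_direction Dr.
Qed.

Lemma tight_exists k : exists2 z, feasible n 1 z & tight k z.
Proof.
case: k => [[p|p]|[p nf]] /=.
- by exists (fun=> 0%N); first exact: feasible0.
- by exists (fun q => q == p : nat); [exact: feasible1|rewrite eqxx].
- exists (fun q => q == p : nat); first exact: feasible1.
  by have [_ _ /andP[? _]] := position_bounds n p; rewrite !csum_unit; lia.
Qed.

Lemma affine_hull_facet k :
  affine_hull (facet k) = [set x | dot (coef k) x = bound k].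
Proof.
have [z fz tz] := tight_exists k.
apply: (affine_hull_hyperplane _ _ _ _ _ (point z)).
- by move=> s [].
- exact/facet_point.
- exact: facet_kernel.
Qed.

Lemma coef_neq0 k : exists w, dot (coef k) w != 0.
Proof.
suff [p hp] : exists p, coef k p != 0 by exists (unit p); rewrite dot_unit.
case: k => [[p|p]|[p nf]]; exists p; rewrite /= ?eqxx ?oppr_eq0 ?oner_eq0 //.
have [_ _ /andP[? _]] := position_bounds n p.
by rewrite leqnn gtn_eqF ?subr0 ?oner_eq0 //; lia.
Qed.

Lemma affine_dim_BTP : has_affine_dim (BTP R n) (\dim {:E}).
Proof.
have P0 : BTP R n (point (fun=> 0%N)) by apply: BTP_point; exact: feasible0.
apply: (affine_dim_full _ _ _ _ P0) => u; rewrite (sum_unit u).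
apply: direction_sum => q; apply: directionZ.
rewrite -[unit q]subr0 (_ : 0 = point (fun=> 0%N)); last first.
  by apply/ffunP => p; rewrite !ffunE.
by apply: directionB => //; apply: BTP_point; exact: feasible1.
Qed.

(** * Validity of the inequalities and completeness of the list *)

Lemma BTP_le k x : BTP R n x -> dot (coef k) x <= bound k.
Proof.
move: x; apply: BTP_ind => [z fz|x y a a0 a1 hx hy]; first exact: dot_coef_le.
by rewrite linearD !linearZ /= /GRing.scale /=; nra.
Qed.

(** If every maximizing triangle were tight, convex combinations would make every maximizer in the
    polytope tight. *)
Lemma nontight_point (f : {linear E -> R^o}) (b : R) k :
  (forall x, BTP R n x -> f x <= b) ->
  (exists2 x, BTP R n x & f x = b /\ dot (coef k) x != bound k) ->
  exists2 z, feasible n 1 z & f (point z) = b /\ ~~ tight k z.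
Proof.
move=> fb [x Px [fx gx]]; apply: contrapT => h; case/eqP: gx.
suff: f x <= b /\ (f x = b -> dot (coef k) x = bound k) by case=> _; apply.
move: x Px {fx}; apply: BTP_ind => [z fz|x y a a0 a1 [hx ex] [hy ey]].
  split=> [|fz']; first by apply: fb; exact: BTP_point.
  by apply/tightP/negPn/negP => nt; apply: h; exists z.
rewrite !linearD !linearZ /= /GRing.scale /=; split; first by nra.
(* Both weights are positive and both values are at most [b], so a mean equal to [b] forces equality
   at each end. *)
move=> e; have [fx fy] : f x = b /\ f y = b by split; nra.
by rewrite ex // ey // -mulrDl subrKC mul1r.
Qed.

Lemma dilate_le (f : {linear E -> R^o}) (b : R) N z : (0 < N)%N ->
  (forall x, BTP R n x -> f x <= b) -> feasible n N z ->
  f (point z) <= b *+ N.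
Proof.
move=> N0 fb fz.
have -> : z = (fun p => \sum_(j < N) slice n N z j p)%N.
  by apply/funext => p; rewrite sum_slice.
rewrite point_sum linear_sum -[N in leRHS]card_ord -sumr_const.
by apply: ler_sum => j _; apply: fb; apply: BTP_point; exact: feasible_slice.
Qed.

Lemma sum_ltn_slack (I : finType) (a b : I -> nat) i :
  (forall j, a j <= 1 + b j)%N -> a i != (b i).+1 ->
  (\sum_j a j < #|I| + \sum_j b j)%N.
Proof.
move=> le neq; rewrite -sum1_card -big_split /= (bigD1 i) //= [ltnRHS](bigD1 i) //=.
rewrite -addSn leq_add //; first by have := le i; lia.
exact: leq_sum.
Qed.

Lemma BTP_interior (f : {linear E -> R^o}) (b : R) :
  (forall x, BTP R n x -> f x <= b) ->
  (forall k, exists2 x, BTP R n x & f x = b /\ dot (coef k) x != bound k) ->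
  forall x, f x = 0.
Proof.
move=> fb nt; suff f0 q : f (unit q) = 0.
  move=> x; rewrite (sum_unit x) linear_sum big1 // => q _.
  by rewrite linearZ f0; exact: mulr0.
have [k|t ht] := @choice facet_index (position n -> nat)
  (fun k z => [/\ feasible n 1 z, f (point z) = b & ~~ tight k z]).
  by have [z fz [fb' nz]] := nontight_point f b k fb (nt k); exists z.
(* The summand [t k] leaves slack in inequality [k], so at [z] every inequality of the [N]-fold
   dilate is strict, while [f] still attains its maximum there. *)
pose N := #|facet_index|; pose z p := (\sum_k t k p)%N.
have N0 : (0 < N)%N by apply/card_gt0P; exists (inl (inl q)).
have fz : f (point z) = b *+ N.
  rewrite point_sum linear_sum -sumr_const.
  by apply: eq_bigr => k _; have [] := ht k.
have csum_z m i : csum n z m i = (\sum_k csum n (t k) m i)%N.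
  exact: exchange_big.
have z_gt0 p : (0 < z p)%N.
  have [_ _ /= tp] := ht (inl (inl p)).
  by rewrite /z (bigD1 (inl (inl p))) //= ltn_addr // lt0n.
have z_ltN p : (z p < N)%N.
  have [_ _ /= tp] := ht (inl (inr p)).
  have le1 k : (t k p <= 1 + 0)%N by have [[]] := ht k.
  by have := sum_ltn_slack _ _ (fun=> 0%N) _ le1 tp; rewrite big1_eq addn0.
have z_slack p : nonfirst n p ->
    (csum n z (col_of p) (row_of p) < N + csum n z (col_of p).-1 (row_of p))%N.
  move=> nf; have [_ _ /= tp] := ht (inr (exist _ p nf)).
  rewrite !csum_z; apply: (sum_ltn_slack _ _ _ (inr (exist _ p nf))) => // k.
  by have [[_ fk] _ _] := ht k; apply: fk.
have le0 : f (unit q) <= 0.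
  rewrite -(lerD2l (f (point z))) addr0 -linearD -pointD [leRHS]fz.
  apply: dilate_le => //; split=> [p|p nf].
    by have := z_ltN p; have := leq_b1 (p == q); lia.
  by rewrite !csumD !csum_unit; have := z_slack p nf; lia.
have ge0 : 0 <= f (unit q).
  (* Positivity of [z] makes the truncated subtraction exact, so [z] can also be moved one unit
     backwards. *)
  have zE : z = (fun p => (z p - (p == q)) + (p == q))%N.
    by apply/funext => p; rewrite subnK // (leq_trans (leq_b1 _)).
  rewrite -(lerD2l (f (point (fun p => z p - (p == q))%N))) addr0.
  rewrite -linearD -pointD -zE fz.
  apply: dilate_le => //; split=> [p|p nf].
    by have := z_ltN p; lia.
  have := z_slack p nf; rewrite {1 2}zE !csumD !csum_unit; lia.
by apply/eqP; rewrite eq_le le0 ge0.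
Qed.

Lemma facets_BTP : facets (BTP R n) = range facet.
Proof.
apply: (facets_hyperplanes _ _ _ _ (fun k => dot (coef k))).
- exact: BTP_le.
- exact: affine_dim_BTP.
- exact: affine_hull_facet.
- exact: coef_neq0.
- exact: BTP_interior.
Qed.

(** The zero triangle and the single-entry triangles tell the facets apart. Zero lies only on
    lower-bound facets; the single entries on them are all but [p] for a lower bound, just [p] for
    an upper bound, and the column of [p] down to [p] for a triangle inequality. *)
Lemma facet_inj : injective facet.
Proof.
move=> k k' e.
have tE z : feasible n 1 z -> tight k z = tight k' z.
  move=> fz; have fk := facet_point k z fz; rewrite e in fk.
  have fk' := facet_point k' z fz.
  by apply/idP/idP => [/fk/fk'|/fk'/fk].
have t0 := tE _ (feasible0 n); have t1 q := tE _ (feasible1 n q).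
have col_gt0 p : (0 < col_of p)%N by have [_ _ /andP[]] := position_bounds n p.
have t2 p q : tight (inl (inr p)) (fun r => r == q : nat) = (p == q).
  by rewrite /=; case: (p == q).
have t3 p nf q : tight (inr (exist _ p nf)) (fun r => r == q : nat)
    = (col_of q == col_of p) && (row_of q <= row_of p)%N.
  by rewrite /= !csum_unit; have := col_gt0 p; lia.
have t30 p nf : tight (inr (exist _ p nf)) (fun=> 0%N) = false.
  by rewrite /= /csum !big1.
(* A triangle inequality is tight at two distinct single entries, [p'] and the first entry of its
   column; an upper bound is tight at only one. *)
have upper_partial p p' nf :
    ~ forall q, tight (inl (inr p)) (fun r => r == q : nat)
      = tight (inr (exist _ p' nf)) (fun r => r == q : nat).
  move=> h; have [b1 b2 /andP[b3 b4]] := position_bounds n p'.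
  have [|||r [hr hc]] := position_exists n (n - col_of p') (col_of p'); try lia.
  have := h p'; have := h r; rewrite !t2 !t3.
  have -> : (col_of r == col_of p') && (row_of r <= row_of p')%N by lia.
  rewrite eqxx leqnn => /eqP pr /eqP pp'; move: nf {h}; rewrite /nonfirst.
  by move: hr; rewrite -pr pp'; lia.
case: k k' {e tE} t0 t1 => [[p|p]|[p nf]] [[p'|p']|[p' nf']] t0 t1;
  rewrite ?t30 //= in t0.
- by have := t1 p; rewrite /= eqxx; case: (eqVneq p p') => [->|].
- by have := t1 p; rewrite !t2 eqxx => /esym/eqP ->.
- by case: (upper_partial _ _ nf' t1).
- by exfalso; apply: (upper_partial _ _ nf) => q; apply: esym.
have := t1 p'; have := t1 p; rewrite !t3 !eqxx !leqnn /=.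
move=> /esym/andP[/eqP h1 h2] /andP[_ h3].
have pp' : p = p' by apply: position_inj => //; apply/eqP; rewrite eqn_leq h2.
by move: nf nf' {t0 t1}; rewrite pp' => nf nf'; rewrite (bool_irrelevance nf nf').
Qed.

End Facets.

(** * Counting the inequalities *)

Lemma card_staircase n e :
  #|[pred p : 'I_n * 'I_n | n - p.2 + e <= p.1]| = \sum_(i < n) (i - e).
Proof.
rewrite -sum1_card.
rewrite (eq_bigl (fun p : 'I_n * 'I_n => true && (n - p.2 + e <= p.1))) //.
rewrite -(pair_big_dep xpredT (fun i j : 'I_n => n - j + e <= i) (fun _ _ => 1)).
(* Reversing the column index turns the condition into [j < i - e]. The offset [e] is 0 for all
   positions and 1 for those after the first of their column. *)
apply: eq_bigr => i _; rewrite (reindex_inj rev_ord_inj) /=.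
have le_n : i - e <= n by have := ltn_ord i; lia.
rewrite (eq_bigl (fun j : 'I_n => j < i - e)); last first.
  by move=> j /=; have := ltn_ord j; lia.
by rewrite -(big_ord_widen n (fun=> 1) le_n) sum1_card card_ord.
Qed.

Lemma card_position n : #|position n| = 'C(n, 2).
Proof.
rewrite card_sig -bin2_sum big_mkord.
rewrite -(eq_bigr _ (fun (i : 'I_n) _ => subn0 i)) -card_staircase.
by apply: eq_card => -[i j]; rewrite !inE /= addn0 subn_gt0 ltn_ord.
Qed.

Lemma card_nonfirst n : #|{: {p | nonfirst n p}}| = 'C(n.-1, 2).
Proof.
transitivity (\sum_(i < n) (i - 1)).
  rewrite card_sig -(fintype.card_image (@val_inj _ _ (position n))) -card_staircase.
  apply: eq_card => x; rewrite !inE addn1.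
  apply/fintype.imageP/idP => [[p nfp ->] //|h].
  have hx : 1 <= n - x.2 <= x.1 by rewrite subn_gt0 ltn_ord ltnW.
  by exists (exist _ x hx).
case: n => [|n]; first by rewrite big_ord0.
rewrite big_ord_recl /= add0n -bin2_sum big_mkord.
by apply: eq_bigr => i _; rewrite /= subn1.
Qed.

Lemma card_facet_index n : 0 < n ->
  #|facet_index n| = ((n - 1) * (3 * n - 2)) %/ 2.
Proof.
case: n => // n _; rewrite !card_sum card_position card_nonfirst /= binS bin1.
(* Stated additively, this keeps the final identity free of division and truncated subtraction. *)
have double_bin m : 2 * 'C(m, 2) + m = m * m.
  by elim: m => // m; rewrite binS bin1; nia.
rewrite -[LHS](mulnK _ (isT : 0 < 2)); congr (_ %/ 2).
by have := double_bin n; nia.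
Qed.

Local Open Scope classical_set_scope.
Local Open Scope card_scope.

Theorem theorem5p4 (R : realType) (n : nat) (hn : (0 < n)%N) :
  facets (BTP R n) #= `I_(((n - 1) * (3 * n - 2)) %/ 2)%N.
Proof.
rewrite facets_BTP -card_facet_index //.
have rank_image : enum_rank @` [set: facet_index n] = [set: 'I_#|facet_index n|].
  by apply/seteqP; split=> // i _; exists (enum_val i) => //; rewrite enum_valK.
apply: card_eq_trans (card_esym card_II); rewrite -rank_image.
apply: card_eq_trans (card_esym _); apply: inj_card_eq => x y _ _.
  exact: facet_inj.
exact: enum_rank_inj.
Qed.
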